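(* Let $n>5$ be an integer and let $K=\{123,321\}\{213,231\}$. There are exactly $3$ equivalence classes of $S_n$ under $K$-equivalence.
   Context: Permutations in $S_n$ are written as words $\pi_1\pi_2\cdots\pi_n$ in one-line notation. The order permutation of a word $u$ of $c$ distinct positive integers is the unique $\sigma\in S_c$ with $\sigma_i<\sigma_j$ iff $u_i<u_j$. A replacement partition $K$ of $S_c$ is a set partition of $S_c$; it is denoted by listing its parts with the one-element parts (and outer brackets) omitted, so here $K$ is the set partition of $S_3$ whose only parts of size greater than one are $\{123,321\}$ and $\{213,231\}$. The $K$-equivalence on $S_n$ is the equivalence relation generated by: $\phi\equiv\psi$ whenever $\phi=aub$ and $\psi=avb$ (concatenations) for some possibly empty words $a,b$ and words $u,v$ of length $c$ (so $u,v$ occupy the same $c$ consecutive positions) such that the order permutations of $u$ and $v$ lie in the same part of $K$. All equivalence classes are counted, including one-element classes. *)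

(* Defs.v *)
From mathcomp Require Import all_boot all_fingroup.
From mathcomp Require Import boolp.
From Stdlib Require Import Relations.

Set Implicit Arguments.
Unset Strict Implicit.
Unset Printing Implicit Defensive.

(* 'S_n permutes {0, ..., n-1}; words use the letters 1, ..., n. *)
Definition one_line (n : nat) (phi : 'S_n) : seq nat :=
  [seq (phi i).+1 | i <- enum 'I_n].

Definition is_order_perm (c : nat) (u : c.-tuple nat) (s : 'S_c) : Prop :=
  forall i j : 'I_c, (s i < s j) <-> (tnth u i < tnth u j).

Definition part_of_words (c : nat) (ws : seq (seq nat)) : {set 'S_c} :=
  [set s : 'S_c | one_line s \in ws].

(* The bracket notation for set partitions of S_c: B lists some parts, and every
   permutation not covered by them is a part on its own. *)
Definition replacement_partition (c : nat) (B : {set {set 'S_c}}) :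
    {set {set 'S_c}} :=
  B :|: [set [set s] | s in ~: cover B].

Definition K_step (c : nat) (K : {set {set 'S_c}}) (n : nat)
    (phi psi : 'S_n) : Prop :=
  exists (a b : seq nat) (u v : c.-tuple nat),
    [/\ one_line phi = a ++ u ++ b,
        one_line psi = a ++ v ++ b
      & exists (P : {set 'S_c}) (s t : 'S_c),
          [/\ P \in K, s \in P, t \in P, is_order_perm u s
            & is_order_perm v t]].

Definition K_equiv (c : nat) (K : {set {set 'S_c}}) (n : nat) :
    'S_n -> 'S_n -> Prop :=
  clos_refl_sym_trans 'S_n (@K_step c K n).

Lemma K_equiv_equivalence (c : nat) (K : {set {set 'S_c}}) (n : nat) :
  equivalence_rel (fun phi psi : 'S_n => `[< K_equiv K phi psi >]).
Proof.
move=> x y z; split; first by apply/asboolP; apply: rst_refl.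
move=> /asboolP xy; apply/asboolP/asboolP => h.
  by apply: rst_trans h; apply: rst_sym.
exact: rst_trans h.
Qed.

Definition K_classes (c : nat) (K : {set {set 'S_c}}) (n : nat) :
    {set {set 'S_n}} :=
  equivalence_partition (fun phi psi => `[< K_equiv K phi psi >])
    [set: 'S_n].

Definition K_123_321_213_231 : {set {set 'S_3}} :=
  replacement_partition
    [set part_of_words 3 [:: [:: 1; 2; 3]; [:: 3; 2; 1]];
         part_of_words 3 [:: [:: 2; 1; 3]; [:: 2; 3; 1]]].

(* Main.v *)
Require Import Defs.
From mathcomp Require Import all_boot all_fingroup.
From mathcomp Require Import boolp zify.
From Stdlib Require Import Relations.

Set Implicit Arguments.
Unset Strict Implicit.
Unset Printing Implicit Defensive.

(** The equivalence swaps [x] and [z] in a factor [x y z] whose middle letter is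
    the median, and swaps [y] and [z] when the first letter is the median. Call
    a word active if some factor of length three has its median in first or
    middle position, so that a swap applies to it.

    In an inactive word every factor [x y z] has its median last, so all letters
    after [x y] lie strictly between [x] and [y] ([inactive_between]). This
    forces the word to be one of the two spirals 1, n, 2, n-1, ... and
    n, 1, n-1, 2, ... ([inactive_spiral]), which are two singleton classes.

    All active words with the same n >= 6 distinct letters are equivalent
    ([active_eqv]), by induction on n. For n = 6 a graph search from the
    increasing word reaches every active word. For n >= 7, an active word has an
    active prefix or an active suffix of length n-1, since an offending triple
    misses one of the two ends. By induction that part may be replaced by any
    active arrangement of the same letters, so the word is equivalent to a word
    [frame s a z] with first letter a, last letter z, and the other letters in
    increasing order. The inner part of a frame has at least five letters in
    increasing order, so both its prefix and its suffix are active, and either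
    end can be changed while the other one is kept. Going through a third
    letter c, one connects any two frames. Hence there are exactly three
    classes. *)

(** * Words and swaps *)

(** [y] lies strictly between [x] and [z], in either order. *)
Definition between (x y z : nat) : bool := (x < y < z) || (z < y < x).

(** One replacement, on words over the natural numbers: 123 <-> 321 in the
    first constructor, 213 <-> 231 in the second. *)
Inductive step : seq nat -> seq nat -> Prop :=
| StepOuter a x y z b : between x y z ->
    step (a ++ [:: x; y; z] ++ b) (a ++ [:: z; y; x] ++ b)
| StepTail a x y z b : between y x z ->
    step (a ++ [:: x; y; z] ++ b) (a ++ [:: x; z; y] ++ b).

(** Equivalence of words, generated by the swaps. *)
Definition eqv : seq nat -> seq nat -> Prop := clos_refl_sym_trans (seq nat) step.

(** Some three consecutive letters have their median in first or middle
    position. *)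
Fixpoint active (w : seq nat) : bool :=
  if w is x :: (y :: z :: _) as t
  then [|| between x y z, between y x z | active t] else false.

Lemma eqv_congr f :
  (forall u v, step u v -> step (f u) (f v)) ->
  forall u v, eqv u v -> eqv (f u) (f v).
Proof.
move=> fS u v; elim=> {u v} [u v uv|u|u v _ uv|u v w _ uv _ vw].
- by apply: rst_step; apply: fS.
- exact: rst_refl.
- exact: rst_sym.
- exact: rst_trans uv vw.
Qed.

Lemma eqv_cons c u v : eqv u v -> eqv (c :: u) (c :: v).
Proof.
apply: eqv_congr => {u v} _ _ [a x y z b xyz|a x y z b xyz].
- exact: (StepOuter (c :: a) b xyz).
- exact: (StepTail (c :: a) b xyz).
Qed.

Lemma eqv_rcons c u v : eqv u v -> eqv (rcons u c) (rcons v c).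
Proof.
apply: (eqv_congr (f := rcons^~ c)) => {u v} _ _ [a x y z b xyz|a x y z b xyz];
  rewrite -!cats1 -!catA.
- exact: (StepOuter a (b ++ [:: c]) xyz).
- exact: (StepTail a (b ++ [:: c]) xyz).
Qed.

Lemma active_cons x w : active w -> active (x :: w).
Proof. by case: w => [|y [|z w]] //= ->; rewrite !orbT. Qed.

Lemma active_catl u w : active w -> active (u ++ w).
Proof. by move=> w_act; elim: u => //= x u; apply: active_cons. Qed.

Lemma active_rcons w x : active w -> active (rcons w x).
Proof.
elim: w => [|a [|b [|c w]] IH] //=.
by case/or3P=> [->|->|/IH /= ->]; rewrite ?orbT.
Qed.

(** Three consecutive letters of a word of length at least four miss its first
    or its last letter. *)
Lemma active_split x y w : 1 < size w -> active (x :: rcons w y) ->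
  active (x :: w) || active (rcons w y).
Proof.
case: w => [|a [|b w]] //= _.
by case/or3P=> [->|->|->] //; rewrite ?orbT.
Qed.

Lemma active_sorted s : 2 < size s -> sorted ltn s -> active s.
Proof.
case: s => [|x [|y [|z s]]] //= _ /and3P[xy yz _].
by rewrite /between xy yz.
Qed.

(** * Words with six letters *)

(** The words obtained from [w] by one swap. *)
Fixpoint moves (w : seq nat) : seq (seq nat) :=
  if w is x :: (y :: z :: b) as t then
    (if between x y z then [:: [:: z, y, x & b]] else [::]) ++
    (if between y x z then [:: [:: x, z, y & b]] else [::]) ++
    [seq x :: u | u <- moves t]
  else [::].

(** Depth-first search along [moves]: [seen] lists the visited words and [todo]
    the stack. It gives up after [fuel] steps. *)
Fixpoint search (fuel : nat) (seen todo : seq (seq nat)) : seq (seq nat) :=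
  if fuel is k.+1 then
    if todo is w :: todo' then
      if w \in seen then search k seen todo'
      else search k (w :: seen) (moves w ++ todo')
    else seen
  else seen.

Lemma between_map (f : nat -> nat) (w : seq nat) x y z :
  {in w &, {mono f : i j / i < j}} ->
  x \in w -> y \in w -> z \in w -> between (f x) (f y) (f z) = between x y z.
Proof. by move=> fM xw yw zw; rewrite /between !fM. Qed.

Lemma active_map (f : nat -> nat) (w : seq nat) :
  {in w &, {mono f : i j / i < j}} -> active (map f w) = active w.
Proof.
elim: w => [|x [|y [|z w]] IH] // fM.
have := IH; rewrite /= => -> ; last first.
  by move=> i j iw jw; apply: fM; rewrite inE ?iw ?jw orbT.
by rewrite !(between_map fM) // !inE eqxx ?orbT.
Qed.

(** A relabelling of the letters that preserves their order preserves swaps. *)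
Lemma moves_step (f : nat -> nat) (w w' : seq nat) :
  {in w &, {mono f : i j / i < j}} -> w' \in moves w ->
  eqv (map f w) (map f w') /\ perm_eq w w'.
Proof.
elim: w w' => [|x [|y [|z w]] IH] // w' fM.
rewrite [moves _]/= -/(moves [:: y, z & w]) !mem_cat => /or3P[].
- case: ifP => // xyz; rewrite inE => /eqP->; split.
    by apply: rst_step; apply: (@StepOuter [::]);
      rewrite (between_map fM) // !inE eqxx ?orbT.
  by apply/seq.permP => p /=; lia.
- case: ifP => // xyz; rewrite inE => /eqP->; split.
    by apply: rst_step; apply: (@StepTail [::]);
      rewrite (between_map fM) // !inE eqxx ?orbT.
  by apply/seq.permP => p /=; lia.
- case/mapP=> u /IH[|fu pu ->].
    by move=> i j iw jw; apply: fM; rewrite inE ?iw ?jw orbT.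
  by split; [exact: eqv_cons|rewrite perm_cons].
Qed.

(** The search only visits words that are equivalent to its starting point, and
    stay so after an order-preserving relabelling. *)
Lemma search_eqv (f : nat -> nat) (w0 : seq nat) fuel seen todo :
  {in w0 &, {mono f : i j / i < j}} ->
  let good w := eqv (map f w0) (map f w) /\ perm_eq w0 w in
  {in seen, forall w, good w} -> {in todo, forall w, good w} ->
  {in search fuel seen todo, forall w, good w}.
Proof.
move=> fM good; elim: fuel seen todo => [|k IH] seen [|w todo] //= seenP todoP.
have [w_good pw] : good w by apply: todoP; rewrite inE eqxx.
have todoP' : {in todo, forall w, good w}.
  by move=> u u_in; apply: todoP; rewrite inE u_in orbT.
case: ifP => _; first exact: IH.
apply: IH => u.
  by rewrite inE => /predU1P[->|/seenP].
rewrite mem_cat => /orP[uw|/todoP'] //.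
have [] := moves_step (f := f) _ uw.
  by move=> i j; rewrite -!(perm_mem pw); apply: fM.
move=> wu pwu; split; first exact: rst_trans w_good wu.
exact: perm_trans pw pwu.
Qed.

(** The result of the search is bound by a [let] so that it is evaluated only
    once, and the fuel is hidden by the existential so that it is never
    evaluated again. *)
Lemma search6_all : exists k, let seen := search k [::] [:: iota 0 6] in
  all (fun w => active w ==> (w \in seen)) (permutations (iota 0 6)).
Proof.
(* The 718 active words have 1920 moves in total, and each move is put on the
   stack once. *)
by exists 2000; vm_compute.
Qed.

Lemma search6_complete : exists k, forall v : seq nat,
  perm_eq v (iota 0 6) -> active v -> v \in search k [::] [:: iota 0 6].
Proof.
have [k /allP found] := search6_all; exists k => v v_perm.
by apply/implyP/found; rewrite mem_permutations.
Qed.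

Lemma eqv6 (w w' : seq nat) :
  size w = 6 -> uniq w -> perm_eq w w' -> active w -> active w' -> eqv w w'.
Proof.
move=> w6 wu ww'; set s := sort leq w; set f := nth 0 s.
have sw : s =i w by move=> i; rewrite mem_sort.
have size_s : size s = 6 by rewrite size_sort.
have s_uniq : uniq s by rewrite sort_uniq.
have s_sorted : sorted ltn s.
  by rewrite ltn_sorted_uniq_leq s_uniq sort_sorted //; apply: leq_total.
have fM : {in iota 0 6 &, {mono f : i j / i < j}}.
  move=> i j; rewrite !mem_iota !add0n /= => i6 j6.
  have fH := sorted_ltn_nth ltn_trans 0 s_sorted.
  case: (ltngtP i j) => [ij|ji|->]; last exact: ltnn.
    by apply: fH; rewrite ?inE ?size_s.
  by apply/negbTE; rewrite -leqNgt ltnW //; apply: fH; rewrite ?inE ?size_s.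
suff base u : perm_eq w u -> active u -> eqv (map f (iota 0 6)) u.
  move=> /(base w (perm_refl _)) bw /(base w' ww') bw'.
  by apply: rst_trans bw'; apply: rst_sym.
(* [v] replaces each letter of [u] by its rank, so that [map f v = u]. *)
move=> wu_perm u_act; pose v := map (index^~ s) u.
have fv : map f v = u.
  rewrite -map_comp -[RHS]map_id; apply/eq_in_map => i iu /=.
  by rewrite /f nth_index // sw (perm_mem wu_perm).
have v_perm : perm_eq v (iota 0 6).
  have -> : iota 0 6 = map (index^~ s) s.
    rewrite -size_s; apply: (@eq_from_nth _ 0); rewrite ?size_map ?size_iota // => i i_s.
    by rewrite nth_iota // (nth_map 0) // index_uniq.
  by apply: perm_map; rewrite perm_sym /s perm_sort.
have [k /(_ v v_perm)] := search6_complete.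
rewrite -(active_map (f := f)) ?fv; last first.
  by move=> i j; rewrite !(perm_mem v_perm); apply: fM.
move=> /(_ u_act) v_reached.
have start_ok : {in [:: iota 0 6], forall u',
    eqv (map f (iota 0 6)) (map f u') /\ perm_eq (iota 0 6) u'}.
  by move=> u'; rewrite inE => /eqP->; split; [exact: rst_refl|].
have nil_ok : {in [::], forall u',
    eqv (map f (iota 0 6)) (map f u') /\ perm_eq (iota 0 6) u'} by [].
by have [+ _] := search_eqv fM nil_ok start_ok v_reached; rewrite fv.
Qed.

(** * Longer words *)

(** The word with first letter [a], last letter [z], and the other letters of
    [s] between them in the order of [s]. *)
Definition frame (s : seq nat) (a z : nat) : seq nat :=
  a :: rcons [seq x <- s | (x != a) && (x != z)] z.

Section Frame.
Variable s : seq nat.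
Hypotheses (s_sorted : sorted ltn s) (s_size : 6 < size s).

Let s_uniq : uniq s.
Proof. by move: s_sorted; rewrite ltn_sorted_uniq_leq => /andP[]. Qed.

Lemma frame_perm a z : a \in s -> z \in s -> a != z -> perm_eq s (frame s a z).
Proof.
move=> a_s z_s a_z; apply: uniq_perm => //.
  rewrite /frame /= rcons_uniq filter_uniq // mem_rcons inE !mem_filter.
  by rewrite (negbTE a_z) !eqxx andbF.
move=> x; rewrite /frame inE mem_rcons inE mem_filter.
by do 2!case: eqVneq => [->|_] //=.
Qed.

Lemma active_inner a z : a \in s -> z \in s -> a != z ->
  active [seq x <- s | (x != a) && (x != z)].
Proof.
move=> a_s z_s a_z; apply: active_sorted.
  by have := perm_size (frame_perm a_s z_s a_z); rewrite /= size_rcons; lia.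
by apply: sorted_filter => //; apply: ltn_trans.
Qed.

(* The induction hypothesis: words with one letter less. *)
Hypothesis shorter : forall w w' : seq nat, size w = (size s).-1 ->
  uniq w -> perm_eq w w' -> active w -> active w' -> eqv w w'.

Lemma eqv_frame_head a w z : perm_eq s (a :: w) -> active w -> z \in w ->
  eqv (a :: w) (frame s a z).
Proof.
move=> sw w_act zw; have := s_uniq; rewrite (perm_uniq sw) /= => /andP[aw w_uniq].
have a_z : a != z by apply: contraNneq aw => ->.
have a_s : a \in s by rewrite (perm_mem sw) inE eqxx.
have z_s : z \in s by rewrite (perm_mem sw) inE zw orbT.
apply: eqv_cons; apply: shorter => //; first by rewrite (perm_size sw).
  by rewrite -(perm_cons a) -(permPl sw) frame_perm.
by apply: active_rcons; apply: active_inner.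
Qed.

Lemma eqv_frame_last a w z : perm_eq s (rcons w z) -> active w -> a \in w ->
  eqv (rcons w z) (frame s a z).
Proof.
move=> sw w_act aw; have := s_uniq; rewrite (perm_uniq sw) rcons_uniq => /andP[zw w_uniq].
have a_z : a != z by apply: contraNneq zw => <-.
have z_s : z \in s by rewrite (perm_mem sw) mem_rcons inE eqxx.
have a_s : a \in s by rewrite (perm_mem sw) mem_rcons inE aw orbT.
rewrite /frame -rcons_cons; apply: eqv_rcons; apply: shorter => //.
- by rewrite (perm_size sw) size_rcons.
- have := frame_perm a_s z_s a_z; rewrite (permPl sw) /frame -rcons_cons.
  by rewrite -!cats1 perm_cat2r.
- by apply: active_cons; apply: active_inner.
Qed.

Lemma eqv_frame_changel a a' z : a \in s -> a' \in s -> z \in s ->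
  a != z -> a' != z -> eqv (frame s a z) (frame s a' z).
Proof.
move=> a_s a'_s z_s a_z a'_z; rewrite {1}/frame -rcons_cons.
apply: eqv_frame_last; first exact: frame_perm.
  by apply: active_cons; apply: active_inner.
by rewrite inE mem_filter a'_s a'_z; case: eqVneq.
Qed.

Lemma eqv_frame_changer a z z' : a \in s -> z \in s -> z' \in s ->
  a != z -> a != z' -> eqv (frame s a z) (frame s a z').
Proof.
move=> a_s z_s z'_s a_z a_z'; apply: eqv_frame_head; first exact: frame_perm.
  by apply: active_rcons; apply: active_inner.
by rewrite mem_rcons inE mem_filter z'_s (eq_sym z' a) a_z' /= andbT; case: eqVneq.
Qed.

Lemma frame_eqv a z a' z' : a \in s -> z \in s -> a' \in s -> z' \in s ->
  a != z -> a' != z' -> eqv (frame s a z) (frame s a' z').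
Proof.
move=> a_s z_s a'_s z'_s a_z a'_z'.
(* A third letter, which makes every intermediate frame well formed even when
   [a = z']. *)
have [c c_s /andP[c_z c_z']] : exists2 c, c \in s & (c != z) && (c != z').
  apply/hasP; apply: contraTT s_size => /hasPn s_small; rewrite -leqNgt.
  apply: (@leq_trans 2) => //; apply: (@uniq_leq_size _ s [:: z; z']) => // x.
  by move=> /s_small; rewrite negb_and !negbK !inE.
apply: rst_trans (eqv_frame_changel a_s c_s z_s a_z c_z) _.
apply: rst_trans (eqv_frame_changer c_s z_s z'_s c_z c_z') _.
exact: eqv_frame_changel.
Qed.

(** The witnesses are the first and the last letter of [w]. *)
Lemma active_frame w : perm_eq s w -> active w ->
  exists a z, [/\ a \in s, z \in s, a != z & eqv w (frame s a z)].
Proof.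
move=> sw w_act; have sz := perm_size sw.
case: w => [|a w] // in sw w_act sz *.
case: (lastP w) => [|{}w z] in sw w_act sz *; first by move: s_size; rewrite sz.
have w_size : 4 < size w by move: s_size; rewrite sz /= size_rcons; lia.
have a_s : a \in s by rewrite (perm_mem sw) inE eqxx.
have z_s : z \in s by rewrite (perm_mem sw) inE mem_rcons inE eqxx orbT.
have a_z : a != z.
  have := s_uniq; rewrite (perm_uniq sw) /= mem_rcons inE.
  by case: eqVneq.
exists a, z; split=> //.
have /orP[pre|suf] : active (a :: w) || active (rcons w z).
- by apply: active_split => //; apply: leq_trans w_size.
- by rewrite -rcons_cons; apply: eqv_frame_last; rewrite ?inE ?eqxx.
- by apply: eqv_frame_head; rewrite ?mem_rcons ?inE ?eqxx.
Qed.

End Frame.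

Lemma active_eqv w w' : 5 < size w -> uniq w -> perm_eq w w' ->
  active w -> active w' -> eqv w w'.
Proof.
have [m] := ubnP (size w); elim: m => // m IH in w w' *.
rewrite ltnS leq_eqVlt => /predU1P[w_m|]; last exact: IH.
rewrite leq_eqVlt => /predU1P[/esym w6|w_size]; first exact: eqv6.
move=> w_uniq ww' w_act w'_act; set s := sort leq w.
have ws : perm_eq s w by rewrite /s perm_sort.
have s_size : 6 < size s by rewrite (perm_size ws).
have s_sorted : sorted ltn s.
  by rewrite ltn_sorted_uniq_leq sort_uniq w_uniq sort_sorted //; apply: leq_total.
have shorter u v : size u = (size s).-1 -> uniq u -> perm_eq u v ->
    active u -> active v -> eqv u v.
  by rewrite (perm_size ws) => u_size; apply: IH; lia.
have [a [z [a_s z_s a_z wF]]] := active_frame s_sorted s_size shorter ws w_act.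
have [a' [z' [a'_s z'_s a'_z' wF']]] :=
  active_frame s_sorted s_size shorter (perm_trans ws ww') w'_act.
apply: rst_trans wF _; apply: rst_trans (rst_sym _ _ _ _ wF').
exact: frame_eqv.
Qed.

(** * Inactive words *)

(** The word lo, lo+len-1, lo+1, lo+len-2, ... on the [len] letters from [lo]
    on if [low] holds, and lo+len-1, lo, lo+len-2, lo+1, ... otherwise. *)
Fixpoint spiral (low : bool) (lo len : nat) : seq nat :=
  if len is l.+1 then
    if low then lo :: spiral false lo.+1 l else lo + l :: spiral true lo l
  else [::].

Lemma size_spiral low lo len : size (spiral low lo len) = len.
Proof. by elim: len low lo => [|l IH] [] lo //=; rewrite IH. Qed.

Lemma spiral_perm low lo len : perm_eq (spiral low lo len) (iota lo len).
Proof.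
elim: len low lo => [|l IH] [] lo //; first by rewrite /= perm_cons.
by rewrite -[in iota _ _]addn1 iotaD /= cats1 perm_sym perm_rcons perm_cons perm_sym.
Qed.

Lemma spiral_inactive low lo len : ~~ active (spiral low lo len).
Proof.
elim: len low lo => [|[|[|l]] IH] [] lo //.
- have := IH false lo.+1; rewrite /= /between; lia.
- have := IH true lo; rewrite /= /between; lia.
Qed.

Lemma inactive_between x y w : uniq [:: x, y & w] -> ~~ active [:: x, y & w] ->
  {in w, forall z, between x z y}.
Proof.
elim: w => [|z w IH] // in x y *; rewrite [uniq _]/= => /andP[xyzw yzw].
rewrite [active _]/= !negb_or => /and3P[n1 n2 n3].
have xzy : between x z y.
  by move: xyzw yzw n1 n2; rewrite /between /= !inE; lia.
move=> t; rewrite inE => /predU1P[->//|tw].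
by have := IH y z yzw n3 t tw; move: xzy; rewrite /between; lia.
Qed.

Lemma inactive_spiral x w lo len : perm_eq (x :: w) (iota lo len) ->
  ~~ active (x :: w) -> x :: w = spiral (x == lo) lo len.
Proof.
elim: len lo x w => [|l IH] lo x w xw; first by have := perm_size xw.
have w_size : size w = l by have := perm_size xw; rewrite /= size_iota => -[].
case: w => [|y w] in xw w_size *.
  move: xw; rewrite -w_size => /perm_mem/(_ x); rewrite !inE eqxx => /esym/eqP->.
  by rewrite eqxx.
move=> xyw_inact; have xyw_uniq : uniq [:: x, y & w] by rewrite (perm_uniq xw) iota_uniq.
have inner := inactive_between xyw_uniq xyw_inact.
have yw_inact : ~~ active (y :: w) by apply: contra xyw_inact; apply: active_cons.
have mem i : (i \in [:: x, y & w]) = (lo <= i < lo + l.+1).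
  by rewrite (perm_mem xw) mem_iota.
have l_gt0 : 0 < l by rewrite -w_size.
have ends i : lo <= i < lo + l.+1 -> [|| i == x, i == y | between x i y].
  by rewrite -mem !inE => /or3P[->|->|/inner->]; rewrite ?orbT.
have x_in : lo <= x < lo + l.+1 by rewrite -mem inE eqxx.
have y_in : lo <= y < lo + l.+1 by rewrite -mem !inE eqxx orbT.
have lo_end := ends lo ltac:(lia); have hi_end := ends (lo + l) ltac:(lia).
have [x_lo|x_lo] := eqVneq x lo.
  subst x; rewrite /=; congr (_ :: _).
  move: xw; rewrite /= perm_cons => /IH/(_ yw_inact)->.
  case: (y =P lo.+1) => // y_lo.
  have -> : l = 1 by move: lo_end hi_end; rewrite /between; lia.
  by rewrite /= addn0.
have y_lo : y = lo by move: lo_end hi_end; rewrite /between; lia.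
have x_hi : x = lo + l by move: lo_end hi_end; rewrite /between; lia.
rewrite /= -x_hi; congr (_ :: _); rewrite -[true](eqxx lo) -{1}y_lo.
apply: IH => //; rewrite -(perm_cons x) (permPl xw) x_hi.
by rewrite -[in iota _ _]addn1 iotaD /= cats1 perm_rcons.
Qed.

(** * From words to permutations *)

Lemma nth_one_line n (phi : 'S_n) (i : 'I_n) : nth 0 (one_line phi) i = (phi i).+1.
Proof. by rewrite (nth_map i) ?size_enum_ord // nth_ord_enum. Qed.

Lemma size_one_line n (phi : 'S_n) : size (one_line phi) = n.
Proof. by rewrite size_map size_enum_ord. Qed.

Lemma one_line_inj n : injective (@one_line n).
Proof.
move=> phi psi eq_w; apply/permP => i; apply/val_inj/succn_inj.
by rewrite -!nth_one_line eq_w.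
Qed.

Lemma one_line_perm n (phi : 'S_n) : perm_eq (one_line phi) (iota 1 n).
Proof.
have w_uniq : uniq (one_line phi).
  by rewrite map_inj_uniq ?enum_uniq // => i j [] /val_inj/perm_inj.
have w_sub : {subset one_line phi <= iota 1 n}.
  by move=> x /mapP[i _ ->]; rewrite mem_iota add1n !ltnS leq0n ltn_ord.
have [|_ w_iota] := uniq_min_size w_uniq w_sub.
  by rewrite size_iota size_one_line.
exact: uniq_perm (iota_uniq _ _) w_iota.
Qed.

Lemma one_line_onto n (w : seq nat) : perm_eq w (iota 1 n) ->
  exists phi : 'S_n, one_line phi = w.
Proof.
move=> w_perm; have w_size : size w = n by rewrite (perm_size w_perm) size_iota.
have w_mem (i : 'I_n) : 0 < nth 0 w i <= n.
  have := mem_nth 0 (s := w) (n := i); rewrite w_size ltn_ord => /(_ isT).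
  by rewrite (perm_mem w_perm) mem_iota add1n ltnS.
have w_lt (i : 'I_n) : (nth 0 w i).-1 < n by have := w_mem i; lia.
have f_inj : injective (fun i => Ordinal (w_lt i)).
  move=> i j /(congr1 val) /= eq_ij; apply/val_inj/eqP.
  rewrite -(nth_uniq 0 (s := w)) ?w_size ?ltn_ord //; last first.
    by rewrite (perm_uniq w_perm) iota_uniq.
  have [/andP[i0 _] /andP[j0 _]] := (w_mem i, w_mem j).
  by rewrite -(prednK i0) eq_ij prednK.
exists (perm f_inj); apply: (@eq_from_nth _ 0); rewrite size_one_line ?w_size // => i i_n.
rewrite (nth_one_line _ (Ordinal i_n)) permE /= prednK //.
by have /andP[] := w_mem (Ordinal i_n).
Qed.

(** The shift by one in [one_line] does not affect comparisons, so an order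
    permutation can be recognised on its one-line word. *)
Lemma order_permP c (u : c.-tuple nat) (s : 'S_c) : is_order_perm u s <->
  forall i j, i < c -> j < c ->
    (nth 0 (one_line s) i < nth 0 (one_line s) j) = (nth 0 u i < nth 0 u j).
Proof.
split=> us i j => [i_c j_c|].
  rewrite (nth_one_line s (Ordinal i_c)) (nth_one_line s (Ordinal j_c)) ltnS.
  apply/idP/idP; have := us (Ordinal i_c) (Ordinal j_c);
  by rewrite !(tnth_nth 0) /= => -[? ?].
have := us i j (ltn_ord i) (ltn_ord j).
by rewrite !nth_one_line ltnS !(tnth_nth 0) => ->.
Qed.

Lemma order_perm3 (u : 3.-tuple nat) (s : 'S_3) p q r x y z :
  one_line s = [:: p; q; r] -> u = [:: x; y; z] :> seq nat ->
  is_order_perm u s <->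
  [/\ ((p < q) = (x < y)) * ((q < p) = (y < x)),
      ((p < r) = (x < z)) * ((r < p) = (z < x))
    & ((q < r) = (y < z)) * ((r < q) = (z < y))].
Proof.
move=> s_w u_w; apply: (iff_trans (order_permP u s)); rewrite s_w u_w; split=> [us|].
  by split; split; [exact: (us 0 1)|exact: (us 1 0)|exact: (us 0 2)|exact: (us 2 0)
                    |exact: (us 1 2)|exact: (us 2 1)].
by move=> [[? ?] [? ?] [? ?]] [|[|[|i]]] [|[|[|j]]] //= _ _; rewrite !ltnn.
Qed.

Local Notation K := K_123_321_213_231.

(** The parts of K: the two listed ones and singletons. *)
Lemma K_partP (P : {set 'S_3}) : P \in K ->
  [\/ P = part_of_words 3 [:: [:: 1; 2; 3]; [:: 3; 2; 1]],
      P = part_of_words 3 [:: [:: 2; 1; 3]; [:: 2; 3; 1]]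
    | exists s, P = [set s]].
Proof.
rewrite inE => /orP[|/imsetP[s _ ->]]; last by apply: Or33; exists s.
by rewrite !inE => /orP[] /eqP->; [apply: Or31|apply: Or32].
Qed.

Lemma order_123_321 (u : 3.-tuple nat) (s : 'S_3) x y z :
  u = [:: x; y; z] :> seq nat ->
  s \in part_of_words 3 [:: [:: 1; 2; 3]; [:: 3; 2; 1]] ->
  is_order_perm u s -> between x y z.
Proof.
move=> u_w; rewrite !inE => /orP[]/eqP s_w /(order_perm3 s_w u_w) /= [[??][??][??]];
by rewrite /between; lia.
Qed.

Lemma order_213_231 (u : 3.-tuple nat) (s : 'S_3) x y z :
  u = [:: x; y; z] :> seq nat ->
  s \in part_of_words 3 [:: [:: 2; 1; 3]; [:: 2; 3; 1]] ->
  is_order_perm u s -> between y x z.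
Proof.
move=> u_w; rewrite !inE => /orP[]/eqP s_w /(order_perm3 s_w u_w) /= [[??][??][??]];
by rewrite /between; lia.
Qed.

Lemma step_sym w w' : step w w' -> step w' w.
Proof.
by case=> a x y z b xyz; constructor; rewrite /between orbC.
Qed.

Lemma perm3_cases (x y z p q r : nat) :
  perm_eq [:: x; y; z] [:: p; q; r] -> uniq [:: x; y; z] ->
  [:: p; q; r] \in [:: [:: x; y; z]; [:: z; y; x]; [:: x; z; y];
                       [:: y; x; z]; [:: y; z; x]; [:: z; x; y]].
Proof.
move=> uv; rewrite (perm_uniq uv) => v_uniq.
have mem i : i \in [:: p; q; r] -> i \in [:: x; y; z] by rewrite (perm_mem uv).
move: (mem p) (mem q) (mem r) v_uniq; rewrite !inE !eqxx ?orbT.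
move=> /(_ isT)/or3P[]/eqP-> /(_ isT)/or3P[]/eqP-> /(_ isT)/or3P[]/eqP->;
  by rewrite /= !inE !eqxx ?orbT ?andbF.
Qed.

(** Equality occurs because [K_step] also relates a permutation to itself, by
    replacing a factor by itself. *)
Lemma K_step_step n (phi psi : 'S_n) : K_step K phi psi ->
  one_line phi = one_line psi \/ step (one_line phi) (one_line psi).
Proof.
case=> a [b] [u] [v] [phi_w psi_w [P] [s] [t] [P_K sP tP us vt]].
have uv : perm_eq u v.
  rewrite -(perm_cat2r b) -(perm_cat2l a) -phi_w -psi_w.
  by rewrite (permPl (one_line_perm phi)) perm_sym one_line_perm.
have : uniq (a ++ u ++ b) by rewrite -phi_w (perm_uniq (one_line_perm phi)) iota_uniq.
rewrite !cat_uniq => /and3P[_ _ /andP[u_uniq _]].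
have [x [y [z u_w]]] : exists x y z, u = [:: x; y; z] :> seq nat.
  by case: (u) => -[|x [|y [|z []]]] //= _; exists x, y, z.
have [p [q [r v_w]]] : exists p q r, v = [:: p; q; r] :> seq nat.
  by case: (v) => -[|x' [|y' [|z' []]]] //= _; exists x', y', z'.
rewrite {}phi_w {}psi_w.
move: u_uniq uv; rewrite u_w v_w => u_uniq /perm3_cases/(_ u_uniq).
case: (K_partP P_K) sP tP => [->|->|[s0 ->]] sP tP.
(* The letter in the middle is the median of both words. *)
- have := order_123_321 v_w tP vt; have := order_123_321 u_w sP us.
  move: u_uniq; rewrite /= !inE => u_uniq xyz pqr.
  case/or4P=> [||| /or3P[]] /eqP[*]; subst p q r;
    by [left|right; constructor|move: u_uniq xyz pqr; rewrite /between; lia].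
(* The first letter is the median of both words. *)
- have := order_213_231 v_w tP vt; have := order_213_231 u_w sP us.
  move: u_uniq; rewrite /= !inE => u_uniq xyz pqr.
  case/or4P=> [||| /or3P[]] /eqP[*]; subst p q r;
    by [left|right; constructor|move: u_uniq xyz pqr; rewrite /between; lia].
(* Words with the same letters and the same order permutation are equal. *)
- move: sP tP us vt; rewrite !inE => /eqP-> /eqP->.
  move=> /order_permP us /order_permP vt.
  have {us vt} uv i j : i < 3 -> j < 3 ->
      (nth 0 [:: x; y; z] i < nth 0 [:: x; y; z] j) =
      (nth 0 [:: p; q; r] i < nth 0 [:: p; q; r] j).
    by move=> i3 j3; rewrite -u_w -v_w -us // vt.
  have := (uv 0 1 isT isT, uv 0 2 isT isT, uv 1 2 isT isT).
  move: u_uniq; rewrite /= !inE => u_uniq [[xy xz] yz].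
  case/or4P=> [||| /or3P[]] /eqP[*]; subst p q r;
    by [left|move: u_uniq xy xz yz; lia].
Qed.

Lemma step_K_step n (phi psi : 'S_n) :
  step (one_line phi) (one_line psi) -> K_step K phi psi.
Proof.
move: (erefl (one_line phi)) (erefl (one_line psi)).
move: {1 3}(one_line phi) {1 3}(one_line psi) => w w' w_phi w'_psi ww'.
have perm_of w0 : perm_eq w0 (iota 1 3) -> exists s : 'S_3, one_line s = w0.
  exact: one_line_onto.
have [s123 w123] := perm_of [:: 1; 2; 3] isT.
have [s321 w321] := perm_of [:: 3; 2; 1] isT.
have [s213 w213] := perm_of [:: 2; 1; 3] isT.
have [s231 w231] := perm_of [:: 2; 3; 1] isT.
case: ww' w_phi w'_psi => a x y z b /orP[] /andP[lt1 lt2] w_phi w'_psi.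
- exists a, b, [tuple x; y; z], [tuple z; y; x]; split=> //.
  exists (part_of_words 3 [:: [:: 1; 2; 3]; [:: 3; 2; 1]]), s123, s321.
  split; rewrite ?inE ?w123 ?w321 ?eqxx ?orbT //.
    by apply/(order_perm3 w123 (erefl _)); do 2!split; lia.
  by apply/(order_perm3 w321 (erefl _)); do 2!split; lia.
- exists a, b, [tuple x; y; z], [tuple z; y; x]; split=> //.
  exists (part_of_words 3 [:: [:: 1; 2; 3]; [:: 3; 2; 1]]), s321, s123.
  split; rewrite ?inE ?w123 ?w321 ?eqxx ?orbT //.
    by apply/(order_perm3 w321 (erefl _)); do 2!split; lia.
  by apply/(order_perm3 w123 (erefl _)); do 2!split; lia.
- exists a, b, [tuple x; y; z], [tuple x; z; y]; split=> //.
  exists (part_of_words 3 [:: [:: 2; 1; 3]; [:: 2; 3; 1]]), s213, s231.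
  split; rewrite ?inE ?w213 ?w231 ?eqxx ?orbT //.
    by apply/(order_perm3 w213 (erefl _)); do 2!split; lia.
  by apply/(order_perm3 w231 (erefl _)); do 2!split; lia.
- exists a, b, [tuple x; y; z], [tuple x; z; y]; split=> //.
  exists (part_of_words 3 [:: [:: 2; 1; 3]; [:: 2; 3; 1]]), s231, s213.
  split; rewrite ?inE ?w213 ?w231 ?eqxx ?orbT //.
    by apply/(order_perm3 w231 (erefl _)); do 2!split; lia.
  by apply/(order_perm3 w213 (erefl _)); do 2!split; lia.
Qed.

Lemma step_perm w w' : step w w' -> perm_eq w w'.
Proof.
by case=> a x y z b _; rewrite perm_cat2l perm_cat2r; apply/seq.permP => p /=; lia.
Qed.

Lemma step_active w w' : step w w' -> active w.
Proof. by case=> a x y z b xyz; apply: active_catl; rewrite /= xyz ?orbT. Qed.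

(** The permutations are quantified inside so that, in the transitive case, the
    intermediate word can be realised by a permutation. *)
Lemma eqv_K_equiv n w w' : eqv w w' -> perm_eq w w' /\
  forall phi psi : 'S_n, one_line phi = w -> one_line psi = w' -> K_equiv K phi psi.
Proof.
elim=> {w w'} [w w' ww'|w|w w' _ [ww' IH]|u v w _ [uv IHu] _ [vw IHv]].
- split=> [|phi psi w_phi w'_psi]; first exact: step_perm.
  by apply: rst_step; apply: step_K_step; rewrite w_phi w'_psi.
- split=> // phi psi <- /one_line_inj->; exact: rst_refl.
- split=> [|phi psi phi_w psi_w]; first by rewrite perm_sym.
  by apply: rst_sym; apply: IH.
- split=> [|phi psi phi_u psi_w]; first exact: perm_trans uv vw.
  have [chi chi_v] : exists chi : 'S_n, one_line chi = v.
    by apply: one_line_onto; rewrite -(permPl uv) -phi_u one_line_perm.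
  by apply: (rst_trans _ _ _ chi); [apply: IHu|apply: IHv].
Qed.

Lemma K_equiv_inactive n (phi psi : 'S_n) : K_equiv K phi psi ->
  phi = psi \/ active (one_line phi) && active (one_line psi).
Proof.
elim=> {phi psi} [phi psi /K_step_step[/one_line_inj|ww']|phi|phi psi _|].
- by left.
- by right; rewrite (step_active ww') (step_active (step_sym ww')).
- by left.
- by case=> [->|]; [left|rewrite andbC; right].
- move=> phi chi psi _ [->|/andP[aphi achi]] _ [<-|/andP[achi' apsi]];
  by [left|right; rewrite ?aphi ?achi ?achi' ?apsi].
Qed.

Lemma K_equiv_active n (phi psi : 'S_n) : 5 < n ->
  active (one_line phi) -> active (one_line psi) -> K_equiv K phi psi.
Proof.
move=> n_gt5 phi_act psi_act.
suff phi_psi : eqv (one_line phi) (one_line psi).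
  by apply: (eqv_K_equiv n phi_psi).2.
apply: active_eqv; rewrite ?size_one_line ?(perm_uniq (one_line_perm _)) ?iota_uniq //.
by rewrite (permPl (one_line_perm phi)) perm_sym one_line_perm.
Qed.

Theorem proposition3p88 (n : nat) (hn : 5 < n) :
  #|K_classes K_123_321_213_231 n| = 3.
Proof.
have [up up_w] := one_line_onto (spiral_perm true 1 n).
have [down down_w] := one_line_onto (spiral_perm false 1 n).
have [incr incr_w] := one_line_onto (perm_refl (iota 1 n)).
have up_in : ~~ active (one_line up) by rewrite up_w spiral_inactive.
have down_in : ~~ active (one_line down) by rewrite down_w spiral_inactive.
have incr_act : active (one_line incr).
  by rewrite incr_w; apply: active_sorted (iota_ltn_sorted _ _); rewrite size_iota; lia.
have inactiveP phi : ~~ active (one_line phi) -> phi = up \/ phi = down.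
  move=> phi_in; have := one_line_perm phi; have := size_one_line phi.
  case phi_w: (one_line phi) => [|x w]; first by
    move=> n0; exfalso; move: hn; rewrite -n0.
  move=> _ xw; rewrite phi_w in phi_in.
  have := inactive_spiral xw phi_in; rewrite -phi_w.
  by case: (x == 1); rewrite -?up_w -?down_w => /one_line_inj->; [left|right].
have up_down : up != down.
  apply: contraTneq hn => /(congr1 (@one_line n)); rewrite up_w down_w.
  by case: (n) => [|[|m]] // [].
(* The three classes are [A] and the two singleton spirals. *)
pose A := [set phi : 'S_n | active (one_line phi)].
have class_of phi : [set psi in [set: 'S_n] | `[< K_equiv K phi psi >]] =
    if active (one_line phi) then A else [set phi].
  apply/setP => psi; rewrite !inE; case: ifP => phi_act; rewrite inE.
    apply/asboolP/idP => [/K_equiv_inactive[<-//|/andP[]//]|].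
    exact: K_equiv_active.
  apply/asboolP/eqP => [/K_equiv_inactive[->//|]|->]; last exact: rst_refl.
  by rewrite phi_act.
have -> : K_classes K n = [set A; [set up]; [set down]].
  apply/setP => C; rewrite !inE; apply/imsetP/idP => [[phi _ ->]|].
    rewrite class_of; case: ifP => [_|/negbT/inactiveP[]->]; by rewrite eqxx ?orbT.
  case/orP=> [/orP[]|] /eqP->; [exists incr|exists up|exists down] => //.
  - by rewrite class_of incr_act.
  - by rewrite class_of (negbTE up_in).
  - by rewrite class_of (negbTE down_in).
have A_up : A != [set up].
  by apply: contraNneq up_in => A_eq; have := set11 up; rewrite -A_eq inE.
have A_down : A != [set down].
  by apply: contraNneq down_in => A_eq; have := set11 down; rewrite -A_eq inE.
by rewrite -setUA cardsU1 cards2 !inE (negbTE A_up) (negbTE A_down)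
  (inj_eq set1_inj) up_down.
Qed.
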